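(* There are absolute constants $C,c>0$ such that the following holds. Let $A\subset\mathbb{R}$ be a finite set with $|A|\ge 2$ and let $M$ be a real number such that $|AA|\le M|A|$. Then $$\mathsf{E}^{+}(A)\le C\,(\log|A|)^{c}\,M^{7/3}\,|A|^{22/9}.$$
   Context: For a finite set $A\subset\mathbb{R}$, $AA=\{ab : a,b\in A\}$ is the product set and $\mathsf{E}^{+}(A)=|\{(a,b,c,d)\in A^4 : a+b=c+d\}|$ is the additive energy. Logarithms are to base $2$. *)

(* Defs.v *)
From HB Require Import structures.
From mathcomp Require Import all_boot all_order all_algebra.
From mathcomp Require Import finmap.
From mathcomp Require Import reals exp.

Set Implicit Arguments.
Unset Strict Implicit.
Unset Printing Implicit Defensive.

Import Order.TTheory GRing.Theory Num.Theory.

Local Open Scope ring_scope.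

Definition product_set (R : realType) (A : {fset R}) : {fset R} :=
  [fset (a * b)%R | a in A, b in A]%fset.

(* A^4 is the left-nested product, so x = (((a, b), c), d). *)
Definition additive_energy (R : realType) (A : {fset R}) : nat :=
  #|` [fset x in A `*` A `*` A `*` A
        | (x.1.1.1 + x.1.1.2 == x.1.2 + x.2)%R]%fset |.

Definition log2 (R : realType) (x : R) : R := ln x / ln 2.

(* Main.v *)
Require Import Defs.
From HB Require Import structures.
From mathcomp Require Import all_boot all_order all_algebra.
From mathcomp Require Import finmap zify ring lra.
From mathcomp Require Import reals exp.

Set Implicit Arguments.
Unset Strict Implicit.
Unset Printing Implicit Defensive.

Import Order.TTheory GRing.Theory Num.Theory.

Local Open Scope ring_scope.

(** Write [B] for [A] without 0, [n] for its size, [P] for [|BB|] and [r d] for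
the number of [b] in [B] with [b + d] in [B]. The energy of [B] is the sum of
[r (x - y)] over [x, y] in [B], and it is compared with
<< Tr = sum over x, y, z in B of r (x - y) * r (y - z) * r (x - z) >>
from both sides.

The matrix with entries [r (x - y)] is a Gram matrix, hence positive
semidefinite; its top eigenvalue is at least [energy / n], so its cube has
trace [Tr] at least [(energy / n) ^ 3] ([cube_le_trace]).

For the upper bound, split the three factors dyadically, and let [D_k] be the
set of [d] with [r d >= k]. A triple counted at levels [k1, k2, k3] yields a
solution of [d + e = f] with [d, e, f] in [D_k1, D_k2, D_k3], and
Cauchy-Schwarz bounds the number of triples by the square root of [N * E3],
where [N] is the number of solutions and [E3] is the sum of the [r d ^ 3], which
also is the second moment of the number of triples above a solution
([triangle_count_sq_le]).

Everything else comes from incidences. If [c] is a nonzero element of [B], then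
[c * (x + b)] lies in [BB] whenever [x + b] is in [B]: each popular difference
[x] is on many of the lines [y = c * (x + b)], and its incidences are with
points of a cartesian product. For cartesian products the Szemeredi-Trotter
bound has an elementary proof by cutting the grid into cells
([incidences_cubed]). It gives [|D_k| <= C P^2 n / k^3], and so the bound for
[E3]; applied to [BB], with multipliers from a subset [X] of [B] for which
[XBB] is small, it gives [|B D_k| <= C P^6 / (k n)^3]; and applied to the lines
[y = c * (x + e)] and the grid made of [D_k1] and [B D_k3] it gives
[N^3 n <= C (|D_k1| |D_k2| |B D_k3|)^2] ([additive_triple_count_le]). This last
step gains a power of [n] over what a bound by [E3] alone yields. The set [X]
comes from the Pluennecke inequality in the form due to Petridis ([petridis]).

Together the powers of the [k_i] cancel: each dyadic block contributes at most
the sixth root of [C log^6 P^26], and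
[energy ^ 18 <= n^18 Tr^6 <= C n^18 log^24 P^26]. As [P <= M |A|], this is the
claim with [M ^ (13 / 9)], and [M >= 1]. *)

(** * Counting by sums of indicators *)

Lemma sum_pick (T : choiceType) (S : {fset T}) (a : T) (F : T -> nat) :
  (\sum_(x <- S) (x == a) * F x = (a \in S) * F a)%N.
Proof.
have [aS|aS] := boolP (a \in S).
  rewrite mul1n (big_fsetD1 a) //= eqxx mul1n big1_fset ?addn0 // => x.
  by rewrite !inE => /andP[/negPf -> _] _.
rewrite mul0n big1_fset // => x xS _.
by case: eqP => // xa; rewrite -xa xS in aS.
Qed.

Lemma mem_sum (T : choiceType) (S : {fset T}) (a : T) :
  (a \in S = \sum_(x <- S) (x == a) :> nat)%N.
Proof.
rewrite -[LHS]muln1 -(sum_pick S a (fun=> 1%N)).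
by apply: eq_bigr => x _; rewrite muln1.
Qed.

Lemma leq_sum_fset (T : choiceType) (S : {fset T}) (F G : T -> nat) :
  (forall x, x \in S -> F x <= G x)%N ->
  (\sum_(x <- S) F x <= \sum_(x <- S) G x)%N.
Proof. by move=> FG; rewrite big_seq [leqRHS]big_seq; apply: leq_sum. Qed.

Lemma sum_fset_const (T : choiceType) (S : {fset T}) (k : nat) :
  (\sum_(x <- S) k = #|` S| * k)%N.
Proof. by rewrite big_const_seq count_predT iter_addn_0 mulnC. Qed.

Lemma sum_fset_leq (T : choiceType) (S : {fset T}) (F : T -> nat) (k : nat) :
  (forall x, x \in S -> F x <= k)%N -> (\sum_(x <- S) F x <= #|` S| * k)%N.
Proof. by move=> Fk; rewrite -sum_fset_const; apply: leq_sum_fset. Qed.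

Lemma card_sep_sum (T : choiceType) (S : {fset T}) (P : pred T) :
  (#|` [fset x in S | P x]%fset| = \sum_(x <- S) P x)%N.
Proof.
rewrite card_fset_sum1 -big_fset_condE big_mkcond.
by apply: eq_bigr => x _; case: (P x).
Qed.

(** * Incidences of lines with a grid *)

(** Summing over fibres, [2 f <= 1 + f ^ 2] holds for each fibre size [f]. *)
Lemma card_le_collisions (T : choiceType) (S : {fset T}) (g : T -> nat) (m : nat) :
  (forall x, x \in S -> g x < m)%N ->
  (#|` S| <= m + \sum_(x <- S) \sum_(y <- S) ((x != y) && (g x == g y)))%N.
Proof.
move=> gm.
pose f (v : nat) := (\sum_(x <- S) (g x == v))%N.
have sum_f : (#|` S| = \sum_(v < m) f v)%N.
  rewrite /f exchange_big /= card_fset_sum1 big_seq [RHS]big_seq.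
  apply: eq_bigr => x xS; rewrite (bigD1 (Ordinal (gm x xS))) //= eqxx big1 // => i.
  by apply: contraNeq => /=; rewrite eqb0 negbK => /eqP gxi; apply/eqP/val_inj.
have sum_f2 : (\sum_(x <- S) \sum_(y <- S) (g x == g y) = \sum_(v < m) f v * f v)%N.
  rewrite (eq_bigr (fun v : 'I_m => \sum_(x <- S) \sum_(y <- S)
      (g x == v) * (g y == v))%N); last first.
    move=> v _; rewrite big_distrl /=; apply: eq_bigr => x _.
    by rewrite big_distrr.
  rewrite [RHS]exchange_big /= big_seq [RHS]big_seq; apply: eq_bigr => x xS.
  rewrite [RHS]exchange_big /=; apply: eq_bigr => y _.
  rewrite (bigD1 (Ordinal (gm x xS))) //= eqxx mul1n eq_sym big1 ?addn0 // => i.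
  move=> ine; case: (g x =P i) => //= gxi; case/eqP: ine; exact/val_inj.
have diag : (\sum_(x <- S) \sum_(y <- S) (g x == g y) =
    #|` S| + \sum_(x <- S) \sum_(y <- S) ((x != y) && (g x == g y)))%N.
  rewrite card_fset_sum1 -big_split /= big_seq [RHS]big_seq; apply: eq_bigr => x xS.
  rewrite (_ : 1 = \sum_(y <- S) (y == x))%N; last by rewrite -mem_sum xS.
  rewrite -big_split /=; apply: eq_bigr => y _; rewrite eq_sym (eq_sym y x).
  by case: (x =P y) => [->|_]; rewrite ?eqxx.
have : (2 * #|` S| <= m + \sum_(v < m) f v * f v)%N.
  have -> : (m + \sum_(v < m) f v * f v = \sum_(v < m) (1 + f v * f v))%N.
    by rewrite big_split /= sum1_card card_ord.
  rewrite sum_f big_distrr /=.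
  by apply: leq_sum => v _; nia.
rewrite -sum_f2 diag; lia.
Qed.

Section Cells.
Variable R : realDomainType.
Implicit Types X Y : {fset R}.

Definition rank X (x : R) := (\sum_(y <- X) (y < x)%R)%N.

Lemma rank_mono X x y : x <= y -> (rank X x <= rank X y)%N.
Proof.
move=> xy; apply: leq_sum => z _.
by case: (boolP (z < x)) => // /lt_le_trans /(_ xy) ->.
Qed.

Lemma rank_lt X x y : x \in X -> x < y -> (rank X x < rank X y)%N.
Proof.
move=> xX xy; rewrite /rank !(big_fsetD1 x xX) /= ltxx xy add0n add1n ltnS.
apply: leq_sum => z _.
by case: (boolP (z < x)) => // /lt_trans /(_ xy) ->.
Qed.

Lemma rank_inj X : {in X &, injective (rank X)}.
Proof.
move=> x y xX yX rxy; case: (ltgtP x y) => // xy.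
  by have := rank_lt xX xy; rewrite rxy ltnn.
by have := rank_lt yX xy; rewrite rxy ltnn.
Qed.

Lemma rank_lt_card X x : x \in X -> (rank X x < #|` X|)%N.
Proof.
move=> xX; rewrite /rank (big_fsetD1 x xX) /= ltxx add0n (cardfsD1 x) xX add1n ltnS.
by rewrite -[leqRHS]muln1; apply: sum_fset_leq => y _; case: (_ < _).
Qed.

(** Cutting [X] into [r] consecutive runs; the width is rounded up so that
   [r] runs always suffice, whatever the size of [X]. *)
Definition cell r X (x : R) := (rank X x %/ (#|` X| %/ r).+1)%N.

Lemma cell_mono r X x y : x <= y -> (cell r X x <= cell r X y)%N.
Proof. by move=> xy; apply/leq_div2r/rank_mono. Qed.

Lemma cell_lt r X x : (0 < r)%N -> x \in X -> (cell r X x < r)%N.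
Proof.
move=> r0 xX; rewrite ltn_divLR //.
have := rank_lt_card xX; have := ltn_ceil #|` X| r0; rewrite mulnC; lia.
Qed.

Lemma cell_neighbours r X x : x \in X ->
  (\sum_(y <- X) ((x != y) && (cell r X x == cell r X y)) <= #|` X| %/ r)%N.
Proof.
move=> xX; rewrite -card_sep_sum -ltnS.
pose Z := [fset y in X | (x != y) && (cell r X x == cell r X y)]%fset.
rewrite -/Z; set w := (#|` X| %/ r).+1.
have xZ : x \notin Z by rewrite !inE eqxx /= andbF.
have -> : (#|` Z|.+1 = #|` (x |` Z)%fset|)%N by rewrite cardfsU1 xZ.
have ZX z : z \in (x |` Z)%fset -> z \in X /\ cell r X x = cell r X z.
  by rewrite !inE => /orP[/eqP ->//|/andP[zX /andP[_ /eqP]]].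
rewrite -(size_map (rank X)) -(size_iota (cell r X x * w) w).
apply: uniq_leq_size => [|k /mapP[z /ZX[zX cz] ->]].
  rewrite map_inj_in_uniq ?fset_uniq // => y z /ZX[yX _] /ZX[zX _].
  exact: rank_inj.
by rewrite mem_iota cz /cell -/w leq_divM -mulSnr ltn_ceil.
Qed.

Lemma cell_collisions r X :
  (r * (\sum_(x <- X) \sum_(y <- X) ((x != y) && (cell r X x == cell r X y)))
    <= #|` X| ^ 2)%N.
Proof.
have [->//|r0] := posnP r.
apply: (@leq_trans (r * (#|` X| * (#|` X| %/ r)))%N).
  by rewrite leq_mul2l sum_fset_leq ?orbT // => x; apply: cell_neighbours.
by rewrite mulnCA -mulnn leq_mul2l mulnC leq_divM orbT.
Qed.

End Cells.

Section Incidences.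
Variable R : realFieldType.
Implicit Types C G X Y : {fset R}.

Definition incidences C G X Y :=
  (\sum_(c <- C) \sum_(b <- G) \sum_(x <- X) ((c * (x + b))%R \in Y))%N.

Definition near r X (x x' : R) := (x != x') && (cell r X x == cell r X x').

(** Along a line both cell indices are monotone, in the same direction or in
   opposite ones, so one signed sum of them identifies the cell. *)
Lemma line_collisions r X Y (c b : R) : c != 0 -> (0 < r)%N ->
  (\sum_(x <- X) ((c * (x + b))%R \in Y) <= 2 * r +
   \sum_(x <- X) \sum_(x' <- X) near r X x x' *
      (((c * (x + b))%R \in Y) * (((c * (x' + b))%R \in Y) *
        near r Y (c * (x + b))%R (c * (x' + b))%R)))%N.
Proof.
move=> c0 r0.
pose h x := c * (x + b).
pose S := [fset x in X | h x \in Y]%fset.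
pose g x := (cell r X x + if (0 < c)%R then cell r Y (h x) else r - cell r Y (h x))%N.
have SXY x : x \in S -> x \in X /\ h x \in Y by rewrite !inE => /andP[].
have g_lt x : x \in S -> (g x < 2 * r)%N.
  move=> /SXY[xX hxY]; rewrite /g; have := cell_lt r0 xX; have := cell_lt r0 hxY.
  by case: (0 < c); lia.
have g_cells x y : x \in S -> y \in S -> x <= y -> g x = g y ->
    cell r X x = cell r X y /\ cell r Y (h x) = cell r Y (h y).
  move=> /SXY[xX hxY] /SXY[yX hyY] xy; rewrite /g.
  have := cell_mono r X xy; have := cell_lt r0 hxY; have := cell_lt r0 hyY.
  case: (ltrP 0 c) => [cp|cn].
    have := cell_mono r Y (_ : h x <= h y); rewrite ler_pM2l ?lerD2r //.
    by move=> /(_ xy); lia.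
  have := cell_mono r Y (_ : h y <= h x).
  rewrite ler_nM2l ?lerD2r ?lt_neqAle ?c0 //.
  by move=> /(_ xy); lia.
have g_near x y : x \in S -> y \in S -> x != y -> g x = g y ->
    near r X x y /\ near r Y (h x) (h y).
  move=> xS yS xy gxy; rewrite /near xy.
  have -> : h x != h y.
    by apply: contra xy => /eqP /(mulfI c0) /addIr ->.
  case/orP: (le_total x y) => [le_xy|le_yx].
    by have [-> ->] := g_cells _ _ xS yS le_xy gxy; rewrite !eqxx.
  by have [-> ->] := g_cells _ _ yS xS le_yx (esym gxy); rewrite !eqxx.
rewrite -(card_sep_sum X (fun x => h x \in Y)) -/S.
apply: leq_trans (card_le_collisions g_lt) _; rewrite leq_add2l.
rewrite -big_fset_condE big_mkcond /=; apply: leq_sum_fset => x xX.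
case: ifP => hxY //; rewrite -big_fset_condE big_mkcond /=; apply: leq_sum_fset => y yX.
case: ifP => hyY //; case: (x =P y) => //= /eqP xy; case: eqP => //= gxy.
have xS : x \in S by rewrite !inE xX.
have yS : y \in S by rewrite !inE yX.
have [nX nY] := g_near _ _ xS yS xy gxy.
by rewrite -/(h x) -/(h y) nX nY.
Qed.

(** For fixed [x <> x'] the values at [x] and [x'] determine [c] and [b], so each
   pair [(y, y')] is met at most once on the left. *)
Lemma two_points_one_line C G Y (x x' : R) (W : R -> R -> nat) :
  0 \notin C -> x != x' ->
  (\sum_(c <- C) \sum_(b <- G) ((c * (x + b))%R \in Y) * (((c * (x' + b))%R \in Y) *
      W (c * (x + b))%R (c * (x' + b))%R)
    <= \sum_(y <- Y) \sum_(y' <- Y) W y y')%N.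
Proof.
move=> C0 xx'; have dx : x - x' != 0 by rewrite subr_eq0.
under eq_bigr => c _ do under eq_bigr => b _ do
  rewrite -(sum_pick Y (c * (x' + b))%R (W (c * (x + b))%R))
    -(sum_pick Y (c * (x + b))%R (fun y => \sum_(y' <- Y) (y' == c * (x' + b))%R * W y y'))%N.
under eq_bigr do rewrite exchange_big /=.
rewrite exchange_big; apply: leq_sum => y _ /=.
under eq_bigr => c _ do under eq_bigr => b _ do rewrite big_distrr /=.
under eq_bigr do rewrite exchange_big /=.
rewrite exchange_big; apply: leq_sum => y' _ /=.
pose c0 := (y - y') / (x - x').
apply: (@leq_trans (\sum_(c <- C) (c == c0) * (\sum_(b <- G) (b == y / c - x)%R * W y y'))%N).
  apply: leq_sum_fset => c cC; have cn0 : c != 0 by apply: contraNneq C0 => <-.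
  rewrite big_distrr; apply: leq_sum => b _ /=.
  case: eqP => //= yE; case: eqP => [y'E|_]; last by rewrite muln0.
  have -> : b == y / c - x by rewrite yE; apply/eqP; field.
  have -> : c = c0 by rewrite /c0 yE y'E; field.
  by rewrite eqxx.
rewrite sum_pick (leq_trans (leq_mul (leq_b1 _) (leqnn _))) // mul1n.
by rewrite sum_pick -[leqRHS]mul1n leq_mul2r leq_b1 orbT.
Qed.

(** A line meets at most [2 r] cells, so it has at most [2 r] points plus the number of
   pairs of its points that share a cell. As two points lie on one line only,
   these pairs, over all lines, number at most the pairs of points of the grid
   sharing a cell. *)
Lemma incidences_cells r C G X Y : 0 \notin C -> (0 < r)%N ->
  (incidences C G X Y * r ^ 2
    <= 2 * r ^ 3 * (#|` C| * #|` G|) + (#|` X| * #|` Y|) ^ 2)%N.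
Proof.
move=> C0 r0.
pose near_pairs (Z : {fset R}) := (\sum_(x <- Z) \sum_(x' <- Z) near r Z x x')%N.
have bound : (incidences C G X Y <= #|` C| * #|` G| * (2 * r)
    + near_pairs X * near_pairs Y)%N.
  apply: (@leq_trans (\sum_(c <- C) \sum_(b <- G) (2 * r +
   \sum_(x <- X) \sum_(x' <- X) near r X x x' *
      (((c * (x + b))%R \in Y) * (((c * (x' + b))%R \in Y) *
        near r Y (c * (x + b))%R (c * (x' + b))%R))))%N).
    apply: leq_sum_fset => c cC; apply: leq_sum => b _; apply: line_collisions => //.
    by apply: contraNneq C0 => <-.
  under eq_bigr do rewrite big_split /= sum_fset_const.
  rewrite big_split /= sum_fset_const mulnA leq_add2l.
  under eq_bigr do rewrite exchange_big /=.
  rewrite exchange_big big_distrl /=; apply: leq_sum => x _.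
  under eq_bigr do rewrite exchange_big /=.
  rewrite exchange_big big_distrl /=; apply: leq_sum => x' _.
  under eq_bigr do rewrite -big_distrr /=.
  rewrite -big_distrr /=; case: (boolP (near r X x x')) => // /andP[xx' _].
  by rewrite !mul1n; apply: (@two_points_one_line _ _ _ _ _ (fun y y' => near r Y y y')).
have := cell_collisions r X; have := cell_collisions r Y.
rewrite -/(near_pairs X) -/(near_pairs Y).
move: (near_pairs X) (near_pairs Y) bound => p q bound hq hp.
have := leq_mul hp hq; rewrite -expnMn.
have := leq_mul bound (leqnn (r ^ 2)%N).
set I := incidences _ _ _ _; set l := (#|` C| * #|` G|)%N; set s := ((_ * _) ^ 2)%N.
rewrite mulnDl [X in (_ <= X + _)%N -> _](_ : _ = 2 * r ^ 3 * l)%N; last by ring.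
rewrite [X in (_ <= _ + X)%N -> _](_ : _ = r * p * (r * q))%N; last by ring.
lia.
Qed.

End Incidences.

(** * The Szemeredi-Trotter bound for cartesian products *)

(** The greatest [r] with [r ^ 3 * l <= q] balances the two terms. For [q < l] a
   single cell is best, and only [l ^ 3] remains. *)
Lemma optimise_cells (I l q : nat) :
  (forall r, 0 < r -> I * r ^ 2 <= 2 * r ^ 3 * l + q)%N ->
  (I ^ 3 <= 1000 * (l ^ 2 * q + l ^ 3))%N.
Proof.
move=> h.
have [l0|l0] := posnP l.
  have := h q.+1 isT; rewrite l0 muln0 add0n.
  by case: I {h} => // I; rewrite -mulnn; nia.
have [ql|lq] := ltnP q l.
  have I3l : (I <= 3 * l)%N by have := h 1%N isT; rewrite !exp1n !muln1; lia.
  have : (I ^ 3 <= (3 * l) ^ 3)%N by rewrite leq_exp2r.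
  rewrite expnMn => /leq_trans; apply.
  by rewrite mulnDr; apply: leq_trans (leq_addl _ _); rewrite leq_mul2r orbT.
have ex : exists r, (r ^ 3 * l <= q)%N by exists 1%N; rewrite exp1n mul1n.
have ub r : (r ^ 3 * l <= q -> r <= q)%N.
  apply: leq_trans; case: r => // r.
  by rewrite -[leqLHS]muln1 leq_mul // -{1}(expn1 r.+1) leq_pexp2l.
case: (ex_maxnP ex ub) => r rq rmax.
have r0 : (0 < r)%N by apply: rmax; rewrite exp1n mul1n.
have qr : (q <= 8 * (r ^ 3 * l))%N.
  have : ~~ (r.+1 ^ 3 * l <= q)%N by apply/negP => /rmax; rewrite ltnn.
  rewrite -ltnNge => /ltnW /leq_trans; apply.
  by rewrite mulnA leq_mul2r -(expnMn 2 r 3) leq_exp2r // orbC; apply/orP; left; lia.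
have Ir : (I <= 10 * (r * l))%N.
  rewrite -(leq_pmul2r (_ : 0 < r ^ 2)%N) ?expn_gt0 ?r0 //.
  apply: leq_trans (h r r0) _.
  have -> : (10 * (r * l) * r ^ 2 = 10 * (r ^ 3 * l))%N by ring.
  have -> : (2 * r ^ 3 * l = 2 * (r ^ 3 * l))%N by ring.
  lia.
have : (I ^ 3 <= (10 * (r * l)) ^ 3)%N by rewrite leq_exp2r.
move=> /leq_trans; apply.
have -> : ((10 * (r * l)) ^ 3 = 1000 * (l ^ 2 * (r ^ 3 * l)))%N by ring.
by rewrite leq_mul2l /= (leq_trans _ (leq_addr _ _)) // leq_mul2l rq orbT.
Qed.

Lemma incidences_cubed (R : realFieldType) (C G X Y : {fset R}) : 0 \notin C ->
  (incidences C G X Y ^ 3 <= 1000 * ((#|` C| * #|` G|) ^ 2 * (#|` X| * #|` Y|) ^ 2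
     + (#|` C| * #|` G|) ^ 3))%N.
Proof. by move=> C0; apply: optimise_cells => r; apply: incidences_cells. Qed.

(** * Product sets and Pluennecke's inequality *)

Section Multiplicative.
Variable R : realFieldType.
Implicit Types B C D G X Y Z : {fset R}.

Definition mulset X Y : {fset R} := [fset x * y | x in X, y in Y]%fset.

Lemma mulsetP X Y z :
  reflect (exists2 x, x \in X & exists2 y, y \in Y & z = x * y) (z \in mulset X Y).
Proof.
apply: (iffP idP) => [/imfset2P[x xX [y yY ->]]|[x xX [y yY ->]]].
  by exists x => //; exists y.
exact: in_imfset2.
Qed.

Lemma mem_mulset X Y x y : x \in X -> y \in Y -> x * y \in mulset X Y.
Proof. by move=> xX yY; apply/mulsetP; exists x => //; exists y. Qed.

Lemma mulsetC X Y : mulset X Y = mulset Y X.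
Proof.
by apply/fsetP => z; apply/mulsetP/mulsetP => -[x xX [y yY ->]];
  exists y => //; exists x => //; rewrite mulrC.
Qed.

Lemma mulset_subl X X' Y : (X `<=` X' -> mulset X Y `<=` mulset X' Y)%fset.
Proof.
move=> /fsubsetP XX'; apply/fsubsetP => _ /mulsetP[x /XX' xX [y yY ->]].
exact: mem_mulset.
Qed.

Lemma mulset_neq0 X Y : 0 \notin X -> 0 \notin Y -> 0 \notin mulset X Y.
Proof.
move=> X0 Y0; apply/negP => /mulsetP[x xX [y yY /esym/eqP]].
by rewrite mulf_eq0 => /orP[]/eqP xy0; [case/negP: X0|case/negP: Y0]; rewrite -xy0.
Qed.

Lemma card_dilate X c : c != 0 -> #|` mulset X [fset c]%fset| = #|` X|.
Proof.
move=> c0; have -> : mulset X [fset c]%fset = [fset x * c | x in X]%fset.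
  apply/fsetP => z; apply/mulsetP/imfsetP => [[x xX [y /fset1P-> ->]]|[x xX ->]].
    by exists x.
  by exists x => //; exists c => //; rewrite inE.
by rewrite card_imfset //; apply: mulIf.
Qed.

Lemma card_mulset_ge X Y y : y \in Y -> y != 0 -> (#|` X| <= #|` mulset X Y|)%N.
Proof.
move=> yY y0; rewrite -(card_dilate X y0) fsubset_leq_card // mulsetC [X in (_ `<=` X)%fset]mulsetC.
by apply: mulset_subl; rewrite fsub1set.
Qed.

Lemma nonempty_nonzero X : 0 \notin X -> X != fset0 -> exists2 x, x \in X & x != 0.
Proof.
move=> X0 /fset0Pn[x xX]; exists x => //.
by apply: contraNneq X0 => <-.
Qed.

(** Induction on [C]: a new factor [c] adds to [XBC] only those products [x b c]
   for which [x] is outside the set [Z] of the [x] with [x B c] inside [XBC]. All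
   [x] with [x c] already in [XC] lie in [Z], so [XC] grows by at least
   [|X| - |Z|], and the minimality of the ratio [|XB| / |X|] compares the two. *)
Lemma petridis B X C : 0 \notin C ->
  (forall Z, Z `<=` X -> #|` mulset X B| * #|` Z| <= #|` mulset Z B| * #|` X|)%N%fset ->
  (#|` mulset (mulset X B) C| * #|` X| <= #|` mulset X B| * #|` mulset X C|)%N.
Proof.
move=> + min; elim/fset1U_rect: C => [_|c C cC IH].
  suff -> : mulset (mulset X B) fset0 = fset0 by rewrite cardfs0.
  by apply/fsetP => z; rewrite inE; apply/negP => /mulsetP[? _ [y]]; rewrite inE.
rewrite !inE negb_or eq_sym => /andP[c0 /IH{IH}]IH.
pose Z := [fset x in X | (mulset (mulset [fset x] B) [fset c] `<=` mulset (mulset X B) C)]%fset.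
have ZX : (Z `<=` X)%fset by apply/fsubsetP => x; rewrite !inE => /andP[].
have mulsetU U : mulset U (c |` C)%fset = (mulset U C `|` mulset U [fset c])%fset.
  apply/fsetP => z; rewrite in_fsetU; apply/mulsetP/orP.
    by move=> [u uU [y /fset1UP[->|yC] ->]]; [right|left]; rewrite mem_mulset ?inE.
  by case=> /mulsetP[u uU [y yC ->]]; exists u => //; exists y => //;
    move: yC; rewrite !inE => ->; rewrite ?orbT.
have leXBC : (#|` mulset (mulset X B) (c |` C)%fset| + #|` mulset Z B| <=
    #|` mulset (mulset X B) C| + #|` mulset X B|)%N.
  rewrite mulsetU -(card_dilate (mulset X B) c0) -(card_dilate (mulset Z B) c0) -[leqRHS]cardfsUI.
  rewrite leq_add2l fsubset_leq_card // fsubsetI; apply/andP; split; last first.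
    exact/mulset_subl/mulset_subl.
  apply/fsubsetP => _ /mulsetP[_ /mulsetP[x xZ [b bB ->]] [y /fset1P-> ->]].
  move: xZ; rewrite !inE /= => /andP[_ /fsubsetP]; apply.
  by rewrite !mem_mulset ?inE.
have geXC : (#|` mulset X C| + #|` X| <= #|` mulset X (c |` C)%fset| + #|` Z|)%N.
  rewrite mulsetU -(card_dilate X c0) -(card_dilate Z c0) -[leqLHS]cardfsUI leq_add2l.
  apply/fsubset_leq_card/fsubsetP => z; rewrite in_fsetI => /andP[zXC].
  move=> /mulsetP[x xX [y /fset1P->]] zE; rewrite zE mem_mulset ?inE //= xX /=.
  apply/fsubsetP => _ /mulsetP[_ /mulsetP[_ /fset1P-> [b bB ->]] [_ /fset1P-> ->]].
  move: zXC; rewrite zE => /mulsetP[x' x'X [c' c'C xc]].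
  by rewrite mulrAC xc mulrAC !mem_mulset.
have := min _ ZX; have := leq_mul leXBC (leqnn #|` X|).
have := leq_mul (leqnn #|` mulset X B|) geXC; move: IH.
rewrite !mulnDl !mulnDr; lia.
Qed.

End Multiplicative.

(** Cross-multiplying avoids rational ratios. *)
Lemma min_ratio (T : eqType) (s : seq T) (f g : T -> nat) :
  s != [::] -> {in s, forall x, 0 < g x}%N ->
  exists2 x, x \in s & {in s, forall y, f x * g y <= f y * g x}%N.
Proof.
elim: s => // x s IH _ gpos.
have [->|s0] := eqVneq s [::].
  by exists x; rewrite ?inE // => y; rewrite inE => /eqP ->.
have [|z zs zmin] := IH s0; first by move=> y ys; apply: gpos; rewrite inE ys orbT.
have gx := gpos x (mem_head _ _).
have gz : (0 < g z)%N by apply: gpos; rewrite inE zs orbT.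
have [xz|zx] := leqP (f x * g z) (f z * g x).
  exists x; rewrite ?mem_head // => y; rewrite inE => /orP[/eqP->//|ys].
  rewrite -(leq_pmul2r gz); have := zmin _ ys; nia.
exists z; rewrite ?inE ?zs ?orbT // => y; rewrite inE => /orP[/eqP->|/zmin//].
exact: ltnW.
Qed.

Section TripleProduct.
Variable R : realFieldType.
Implicit Types B X Y Z : {fset R}.

Lemma mulsetA X Y Z : mulset (mulset X Y) Z = mulset X (mulset Y Z).
Proof.
apply/fsetP => z; apply/mulsetP/mulsetP.
  move=> [_ /mulsetP[x xX [y yY ->]] [w wZ ->]].
  by exists x => //; exists (y * w); rewrite ?mem_mulset ?mulrA.
move=> [x xX [_ /mulsetP[y yY [w wZ ->]] ->]].
by exists (x * y); rewrite ?mem_mulset //; exists w; rewrite ?mulrA.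
Qed.

(** Take for [X] the nonempty subset with the least ratio [|XB| / |X|], so that
   [|XBB| <= |XB|^2 / |X|] by Petridis' inequality. *)
Lemma small_triple_product B : 0 \notin B -> B != fset0 ->
  exists X, [/\ (X `<=` B)%fset, X != fset0 &
    (#|` mulset X (mulset B B)| * #|` B| ^ 2 <= #|` mulset B B| ^ 2 * #|` X|)%N].
Proof.
move=> B0 Bn0.
pose S := [fset Z in fpowerset B | Z != fset0]%fset.
have SE Z : (Z \in S) = (Z `<=` B)%fset && (Z != fset0) by rewrite !inE fpowersetE.
have [||X] := @min_ratio _ S (fun Z => #|` mulset Z B|) (fun Z => #|` Z|).
- have : B \in enum_fset S by rewrite SE fsubset_refl.
  by apply: contraTneq => ->.
- by move=> Z; rewrite SE cardfs_gt0 => /andP[].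
rewrite SE => /andP[XB Xn0] minX; exists X; split => //.
have X0 : (0 < #|` X|)%N by rewrite cardfs_gt0.
have minXZ Z : (Z `<=` X -> #|` mulset X B| * #|` Z| <= #|` mulset Z B| * #|` X|)%N%fset.
  move=> ZX; have [->|Zn0] := eqVneq Z fset0; first by rewrite cardfs0 muln0.
  by apply: minX; rewrite SE Zn0 (fsubset_trans ZX).
have := petridis B0 minXZ; rewrite mulsetA => h1.
have h2 : (#|` mulset X B| * #|` B| <= #|` mulset B B| * #|` X|)%N.
  by apply: minX; rewrite SE fsubset_refl.
rewrite -(leq_pmul2r X0); move: h1 (leq_mul h2 h2).
set Q := (#|` mulset X (mulset B B)|).
rewrite -!mulnn; nia.
Qed.

End TripleProduct.

(** * Popular differences *)

Section Popular.
Variable R : realFieldType.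
Implicit Types B C D G X : {fset R}.

Definition rep G (d : R) := #|` [fset g in G | (g + d)%R \in G]%fset|.

Lemma repE G d : rep G d = (\sum_(g <- G) ((g + d)%R \in G))%N.
Proof. exact: card_sep_sum. Qed.

(** For [c] in [C], every representation of [d] as a difference in [G] puts a
   point of [D x CG] with abscissa [d] on a line [y = c * (x + g)]; hence at least
   [|C| |D| k] incidences. The constant 2000 is twice that of
   [incidences_cubed], as the second term there is at most the first. *)
Lemma popular_differences C G D k : 0 \notin C -> 0 \notin G -> C != fset0 ->
  {in D, forall d, k <= rep G d}%N ->
  (#|` D| * #|` C| * k ^ 3 <= 2000 * (#|` G| ^ 2 * #|` mulset C G| ^ 2))%N.
Proof.
move=> C0 G0 Cn0 kD.
have [->|k0] := posnP k; first by rewrite muln0.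
have [->|Dn0] := eqVneq D fset0; first by rewrite cardfs0.
have Gn0 : G != fset0.
  have [d /kD kd] := fset0Pn _ Dn0; rewrite -cardfs_gt0.
  by apply: leq_trans (leq_trans k0 kd) _; apply/fsubset_leq_card/fset_sub.
have [c cC cn0] := nonempty_nonzero C0 Cn0.
have [g gG gn0] := nonempty_nonzero G0 Gn0.
have GY : (#|` G| <= #|` mulset C G|)%N by rewrite mulsetC (card_mulset_ge _ cC).
have CY : (#|` C| <= #|` mulset C G|)%N by rewrite (card_mulset_ge _ gG).
have inc : (#|` C| * (#|` D| * k) <= incidences C G D (mulset C G))%N.
  rewrite -sum_fset_const; apply: leq_sum_fset => a aC.
  rewrite exchange_big -sum_fset_const; apply: leq_sum_fset => d dD.
  apply: leq_trans (kD _ dD) _; rewrite repE; apply: leq_sum => b _.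
  by rewrite (addrC d); case: (boolP (b + d \in G)) => // h; rewrite mem_mulset.
have := leq_trans _ (incidences_cubed G D (mulset C G) C0).
move/(_ ((#|` C| * (#|` D| * k)) ^ 3)%N); rewrite leq_exp2r // => /(_ inc).
move: GY CY; rewrite -cardfs_gt0 in Cn0; rewrite -cardfs_gt0 in Dn0; move: Cn0 Dn0.
move: #|` C| #|` D| #|` G| #|` mulset C G| => c' d' g' y' Cn0 Dn0 GY CY.
have e : ((c' * g') ^ 3 <= (c' * g') ^ 2 * (d' * y') ^ 2)%N.
  rewrite [leqLHS]expnS mulnC leq_mul2l; apply/orP; right.
  by apply: leq_trans (leq_mul CY GY) _; rewrite expnMn mulnn leq_pmull // expn_gt0 Dn0.
move=> h; have {h}h := leq_trans h (leq_mul (leqnn 1000) (leq_add (leqnn _) e)).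
rewrite -(leq_pmul2l (_ : 0 < (c' * d') ^ 2)%N) ?expn_gt0 ?muln_gt0 ?Cn0 ?Dn0 //.
apply: leq_trans (_ : _ <= (c' * (d' * k)) ^ 3)%N _; first by apply: eq_leq; ring.
by apply: leq_trans h _; apply: eq_leq; ring.
Qed.

Definition diffs B := [fset (a - b)%R | a in B, b in B]%fset.

Lemma mem_diffs B a b : a \in B -> b \in B -> a - b \in diffs B.
Proof. by move=> aB bB; apply: in_imfset2. Qed.

Definition level B k := [fset d in diffs B | (k <= rep B d)%N]%fset.

Lemma level_rep B k : {in level B k, forall d, k <= rep B d}%N.
Proof. by move=> d; rewrite !inE => /andP[]. Qed.

Lemma card_level B k : 0 \notin B ->
  (#|` level B k| * k ^ 3 <= 2000 * (#|` mulset B B| ^ 2 * #|` B|))%N.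
Proof.
move=> B0; have [B_empty|Bn0] := eqVneq B fset0.
  suff -> : level B k = fset0 by rewrite cardfs0.
  apply/fsetP => d; rewrite in_fset0; apply/negP; rewrite inE => /andP[/imfset2P[a]].
  by rewrite B_empty.
have := popular_differences B0 B0 Bn0 (@level_rep B k).
rewrite -cardfs_gt0 in Bn0 => bound; rewrite -(leq_pmul2r Bn0) mulnAC.
apply: leq_trans bound _.
by apply: eq_leq; ring.
Qed.

Lemma rep_dilate B c d : c \in B -> c != 0 -> (rep B d <= rep (mulset B B) (c * d)%R)%N.
Proof.
move=> cB c0.
rewrite /rep -(card_dilate _ c0); apply/fsubset_leq_card/fsubsetP => _ /mulsetP[b + [_ /fset1P-> ->]].
by rewrite !inE mulrC -mulrDr => /andP[bB bdB]; rewrite !mem_mulset.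
Qed.

(** An element [c * d] of this set is a popular difference of [BB]. Its incidences
   are counted with multipliers from the set [X] of [small_triple_product]:
   the whole of [B] would need a bound for [|BBB|]. *)
Lemma card_dilated_level B k : 0 \notin B ->
  (#|` mulset B (level B k)| * k ^ 3 * #|` B| ^ 3 <= 2000 * #|` mulset B B| ^ 6)%N.
Proof.
move=> B0; have [->|Bn0] := eqVneq B fset0; first by rewrite cardfs0 muln0.
have [X [XB Xn0 small]] := small_triple_product B0 Bn0.
have X0 : 0 \notin X by apply: contra B0; apply: (fsubsetP XB).
have popular : {in mulset B (level B k), forall e, k <= rep (mulset B B) e}%N.
  move=> _ /mulsetP[c cB [d /level_rep dk ->]].
  by apply: leq_trans dk (rep_dilate _ cB _); apply: contraNneq B0 => <-.
have := popular_differences X0 (mulset_neq0 B0 B0) Xn0 popular.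
have := fsubset_leq_card XB; rewrite -!cardfs_gt0 in Bn0 Xn0; move: Bn0 Xn0 small.
move: #|` mulset B (level B k)| #|` B| #|` X| #|` mulset X (mulset B B)| #|` mulset B B|.
move=> h n x Q P n0 x0 small xn bound.
rewrite -(leq_pmul2r (_ : 0 < n * x)%N) ?muln_gt0 ?n0 //.
apply: leq_trans (_ : h * x * k ^ 3 * n ^ 4 <= _)%N; first by apply: eq_leq; ring.
apply: leq_trans (leq_mul bound (leqnn _)) _.
apply: leq_trans (_ : 2000 * (P ^ 2 * (Q * n ^ 2) ^ 2) <= _)%N; first by apply: eq_leq; ring.
apply: leq_trans (_ : 2000 * (P ^ 2 * (P ^ 2 * x) ^ 2) <= _)%N.
  by rewrite leq_mul2l leq_mul2l leq_exp2r // small !orbT.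
apply: leq_trans (_ : 2000 * P ^ 6 * (x * x) <= _)%N; first by apply: eq_leq; ring.
by rewrite leq_mul2l leq_mul2r xn !orbT.
Qed.

Definition additive_triple_count D1 D2 D3 :=
  (\sum_(d <- D1) \sum_(e <- D2) ((d + e)%R \in D3))%N.

(** Multiplying [d + e = f] by [c] in [B] puts the point [(d, c f)] of the grid
   [D1 x B D3] on the line [y = c * (x + e)]. The hypothesis makes the main term
   of the incidence bound dominate; it fails only if [D3] is inside [{0}]. *)
Lemma additive_triple_count_le B D1 D2 D3 : 0 \notin B -> B != fset0 ->
  (#|` B| <= #|` mulset B D3|)%N ->
  (additive_triple_count D1 D2 D3 ^ 3 * #|` B|
    <= 2000 * (#|` D1| * #|` D2| * #|` mulset B D3|) ^ 2)%N.
Proof.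
move=> B0 Bn0 nH; rewrite /additive_triple_count.
(* The roles of [d] and [e] are interchangeable; the lines should come from the
   smaller set, so that the main term absorbs their number. *)
wlog D21 : D1 D2 / (#|` D2| <= #|` D1|)%N.
  move=> wlogD; case/orP: (leq_total #|` D2| #|` D1|) => [/wlogD//|/wlogD].
  rewrite exchange_big /= (mulnC #|` D2|); apply: leq_trans; apply: eq_leq.
  by congr (_ ^ 3 * _)%N; apply: eq_bigr => d _; apply: eq_bigr => e _; rewrite addrC.
set N := (\sum_(d <- D1) _)%N.
have inc : (#|` B| * N <= incidences B D2 D1 (mulset B D3))%N.
  rewrite -sum_fset_const; apply: leq_sum_fset => c cB.
  rewrite exchange_big; apply: leq_sum => d _; apply: leq_sum => e _.
  by case: (boolP (_ \in D3)) => // h; rewrite mem_mulset.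
have := leq_trans _ (incidences_cubed D2 D1 (mulset B D3) B0).
move/(_ ((#|` B| * N) ^ 3)%N); rewrite leq_exp2r // => /(_ inc) {inc}.
rewrite -cardfs_gt0 in Bn0; move: Bn0 nH D21.
move: N #|` B| #|` D1| #|` D2| #|` mulset B D3| => N n d1 d2 h n0 nh d21 bound.
rewrite -(leq_pmul2l (_ : 0 < n ^ 2)%N) ?expn_gt0 ?n0 //.
apply: leq_trans (_ : _ <= (n * N) ^ 3)%N _; first by apply: eq_leq; ring.
have e : ((n * d2) ^ 3 <= (n * d2) ^ 2 * (d1 * h) ^ 2)%N.
  rewrite [leqLHS]expnS mulnC leq_mul2l; apply/orP; right.
  by rewrite expnMn mulnC leq_mul // -mulnn; nia.
apply: leq_trans bound _; apply: leq_trans (leq_mul (leqnn _) (leq_add (leqnn _) e)) _.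
by apply: eq_leq; ring.
Qed.

End Popular.

(** * Energy and triangles *)

Lemma cauchy_schwarz (T : Type) (s : seq T) (f g : T -> nat) :
  ((\sum_(i <- s) f i * g i) ^ 2 <= (\sum_(i <- s) f i ^ 2) * (\sum_(i <- s) g i ^ 2))%N.
Proof.
rewrite -(leq_pmul2l (_ : 0 < 2)%N) // -mulnn !big_distrlr /=.
rewrite [X in (_ <= X)%N](_ : _ = \sum_(i <- s) \sum_(j <- s)
    (f i ^ 2 * g j ^ 2 + f j ^ 2 * g i ^ 2))%N; last first.
  under [RHS]eq_bigr do rewrite big_split /=.
  rewrite big_split /= mulSn mul1n; congr (_ + _)%N.
  by rewrite exchange_big.
rewrite big_distrr /=; apply: leq_sum => i _.
rewrite big_distrr /=; apply: leq_sum => j _.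
have := (nat_Cauchy (f i * g j) (f j * g i)).1; rewrite !expnMn => /(leq_trans _); apply.
by apply: eq_leq; ring.
Qed.

(** With [K = V V^T] and [v] the constant unit vector, this is
   [(v, K v) ^ 3 <= (v, K ^ 3 v) <= tr (K ^ 3)]. The moments [(v, K ^ i v)] are
   [1, E / n, a / n, b / n] for [i = 0 .. 3], where [a] and [b] are the sums of
   [d ^ 2] and [w ^ 2] below; they are log-convex by Cauchy-Schwarz because
   [(v, K ^ (2 i + 1) v)] is the squared norm of [V^T K ^ i v]. The trace is the
   sum of the squares of the entries of [W = V^T K]. *)
Lemma cube_le_trace (T U : Type) (s : seq T) (t : seq U) (V : T -> U -> nat)
    (K : T -> T -> nat) :
  (forall x y, K x y = \sum_(u <- t) V x u * V y u)%N ->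
  ((\sum_(x <- s) \sum_(y <- s) K x y) ^ 3
    <= size s ^ 3 * \sum_(z <- s) \sum_(y <- s) \sum_(x <- s) K x y * K y z * K x z)%N.
Proof.
move=> KE; have KC x y : K x y = K y x.
  by rewrite !KE; apply: eq_bigr => u _; rewrite mulnC.
pose q u := (\sum_(x <- s) V x u)%N.
pose d x := (\sum_(y <- s) K x y)%N.
pose w u := (\sum_(x <- s) V x u * d x)%N.
pose W u y := (\sum_(x <- s) V x u * K x y)%N.
set E := (\sum_(x <- s) \sum_(y <- s) K x y)%N.
set Tr := (\sum_(z <- s) _)%N.
have dE x : d x = (\sum_(u <- t) V x u * q u)%N.
  rewrite /d; under eq_bigr do rewrite KE.
  by rewrite exchange_big; apply: eq_bigr => u _; rewrite -big_distrr.
have Eq : (E = \sum_(u <- t) q u ^ 2)%N.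
  rewrite /E; under eq_bigr => x _ do rewrite -/(d x) dE.
  by rewrite exchange_big; apply: eq_bigr => u _ /=; rewrite -mulnn big_distrl.
have E_le : (E ^ 2 <= size s * \sum_(x <- s) d x ^ 2)%N.
  have := cauchy_schwarz s (fun=> 1%N) d.
  by rewrite sum1_size; under eq_bigr do rewrite mul1n.
have dw : (\sum_(x <- s) d x ^ 2 = \sum_(u <- t) q u * w u)%N.
  under [LHS]eq_bigr => x _ do rewrite -mulnn {1}dE big_distrl /=.
  rewrite exchange_big; apply: eq_bigr => u _ /=; rewrite big_distrr /=.
  by apply: eq_bigr => x _; rewrite mulnCA mulnA.
have d_le : ((\sum_(x <- s) d x ^ 2) ^ 2 <= E * \sum_(u <- t) w u ^ 2)%N.
  by rewrite dw Eq; apply: cauchy_schwarz.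
have wW u : w u = (\sum_(y <- s) W u y)%N.
  rewrite /w /W exchange_big; apply: eq_bigr => x _.
  by rewrite -big_distrr.
have TrW : Tr = (\sum_(u <- t) \sum_(y <- s) W u y ^ 2)%N.
  rewrite [RHS]exchange_big /=; apply: eq_bigr => z _.
  under [RHS]eq_bigr => u _ do rewrite -mulnn big_distrlr /=.
  rewrite [RHS]exchange_big /=; apply: eq_bigr => y _ /=.
  rewrite [RHS]exchange_big /=; apply: eq_bigr => x _ /=.
  rewrite KE !big_distrl /=; apply: eq_bigr => u _.
  by ring.
have w_le : (\sum_(u <- t) w u ^ 2 <= size s * Tr)%N.
  rewrite TrW big_distrr; apply: leq_sum => u _ /=; rewrite wW.
  have := cauchy_schwarz s (fun=> 1%N) (W u).
  by rewrite sum1_size; under eq_bigr do rewrite mul1n.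
have [->//|E0] := posnP E.
rewrite -(leq_pmul2l E0) -expnS.
move: E_le d_le w_le; move: (\sum_(x <- s) d x ^ 2)%N (\sum_(u <- t) w u ^ 2)%N => a b.
move=> h1 h2 h3.
apply: leq_trans (_ : (size s * a) ^ 2 <= _)%N; first by rewrite (expnM E 2 2) leq_exp2r.
apply: leq_trans (_ : size s ^ 2 * (E * b) <= _)%N; first by rewrite expnMn leq_mul2l h2 orbT.
apply: leq_trans (_ : size s ^ 2 * (E * (size s * Tr)) <= _)%N.
  by rewrite leq_mul2l leq_mul2l h3 !orbT.
by apply: eq_leq; ring.
Qed.

(** The term [i = trunc_log 2 r] alone suffices. *)
Lemma dyadic_pow n r k : (r <= n -> 0 < k ->
  r ^ k <= 2 ^ k * \sum_(i < (trunc_log 2 n).+1) (2 ^ i) ^ k * (2 ^ i <= r))%N.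
Proof.
move=> rn k0; have [->|r0] := posnP r; first by rewrite exp0n.
have lt : (trunc_log 2 r < (trunc_log 2 n).+1)%N by rewrite ltnS leq_trunc_log.
rewrite (bigD1 (Ordinal lt)) //= trunc_logP // muln1 mulnDr.
apply: leq_trans (leq_addr _ _); rewrite -expnMn leq_exp2r // -expnS ltnW //.
exact: trunc_log_ltn.
Qed.

Section Triangles.
Variable R : realFieldType.
Implicit Types B D : {fset R}.

(** Both sides sum over the pairs [y = z + e]. *)
Lemma sum_shift B D (z : R) (F : R -> nat) :
  (\sum_(y <- B) ((y - z)%R \in D) * F (y - z)%R
    = \sum_(e <- D) ((z + e)%R \in B) * F e)%N.
Proof.
under eq_bigr do rewrite -sum_pick.
rewrite exchange_big; apply: eq_bigr => e _ /=; rewrite mem_sum big_distrl.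
by apply: eq_bigr => y _ /=; rewrite eq_sym subr_eq (addrC e).
Qed.

Lemma sum_shift_le B D (y : R) (F : R -> nat) :
  (\sum_(d <- D) ((y + d)%R \in B) * F (y + d)%R <= \sum_(x <- B) F x)%N.
Proof.
rewrite -(sum_shift B D y (fun d => F (y + d)%R)); apply: leq_sum => x _.
by rewrite subrKC; case: (_ \in D); rewrite ?mul1n.
Qed.

(** Substituting [b = y + u]; this exhibits [rep B (x - y)] as a Gram matrix. *)
Lemma rep_gram B x y : y \in B ->
  rep B (x - y) = (\sum_(u <- diffs B) ((x + u)%R \in B) * ((y + u)%R \in B))%N.
Proof.
move=> yB; rewrite repE; under [RHS]eq_bigr do rewrite mulnC.
rewrite -(sum_shift B (diffs B) y (fun u => ((x + u)%R \in B) : nat)).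
rewrite !big_seq; apply: eq_bigr => b bB; rewrite mem_diffs // mul1n.
by rewrite addrCA addrA addrC.
Qed.

Lemma rep_sym B x y : x \in B -> y \in B -> rep B (x - y) = rep B (y - x).
Proof.
by move=> xB yB; rewrite !rep_gram //; apply: eq_bigr => u _; rewrite mulnC.
Qed.

Lemma rep_le_card B d : (rep B d <= #|` B|)%N.
Proof. exact/fsubset_leq_card/fset_sub. Qed.

Lemma moment_pairs B (F : R -> nat) :
  (\sum_(z <- B) \sum_(y <- B) F (y - z)%R = \sum_(d <- diffs B) rep B d * F d)%N.
Proof.
under [RHS]eq_bigr do rewrite repE big_distrl /=.
rewrite [RHS]exchange_big big_seq [RHS]big_seq; apply: eq_bigr => z zB /=.
rewrite -sum_shift big_seq [RHS]big_seq; apply: eq_bigr => y yB.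
by rewrite mem_diffs // mul1n.
Qed.

Definition energy B := (\sum_(z <- B) \sum_(y <- B) rep B (y - z)%R)%N.

Definition energy3 B := (\sum_(d <- diffs B) rep B d ^ 3)%N.

Definition triangles B := (\sum_(z <- B) \sum_(y <- B) \sum_(x <- B)
  rep B (x - y)%R * rep B (y - z)%R * rep B (x - z)%R)%N.

Lemma energy_le_triangles B : (energy B ^ 3 <= #|` B| ^ 3 * triangles B)%N.
Proof.
pose K x y := (\sum_(u <- diffs B) ((x + u)%R \in B) * ((y + u)%R \in B))%N.
have := @cube_le_trace _ _ B (diffs B) (fun x u => ((x + u)%R \in B) : nat) K (fun=> fun=> erefl).
congr (_ ^ 3 <= _ * _)%N; rewrite big_seq [RHS]big_seq; apply: eq_bigr => z zB.
  rewrite big_seq [RHS]big_seq; apply: eq_bigr => y yB.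
  by rewrite rep_sym // rep_gram.
rewrite big_seq [RHS]big_seq; apply: eq_bigr => y yB.
by apply: eq_bigr => x _; rewrite !rep_gram.
Qed.

Lemma energy3_le B : 0 \notin B ->
  (energy3 B <= (trunc_log 2 #|` B|).+1 * (8 * 2000 * (#|` mulset B B| ^ 2 * #|` B|)))%N.
Proof.
move=> B0; set L := (trunc_log 2 _).+1.
apply: leq_trans (_ : \sum_(d <- diffs B) 2 ^ 3 * \sum_(i < L) (2 ^ i) ^ 3 * (2 ^ i <= rep B d) <= _)%N.
  by apply: leq_sum => d _; apply: dyadic_pow => //; apply: rep_le_card.
rewrite -big_distrr exchange_big /= -mulnA mulnCA leq_mul2l -[X in (_ <= X * _)%N]card_ord.
rewrite -sum_nat_const; apply: leq_sum => i _; rewrite -big_distrr /= -card_sep_sum mulnC.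
exact: card_level.
Qed.

(** The three sides are tested against separate thresholds, because the dyadic
   blocks of a positive semidefinite matrix need not be positive semidefinite. *)
Definition triangle_count B k1 k2 k3 := (\sum_(z <- B) \sum_(y <- B) \sum_(x <- B)
  (k1 <= rep B (x - y)%R) * (k2 <= rep B (y - z)%R) * (k3 <= rep B (x - z)%R))%N.

Lemma triangles_dyadic B (L := (trunc_log 2 #|` B|).+1) :
  (triangles B <= 8 * \sum_(i < L) \sum_(j < L) \sum_(k < L)
     2 ^ i * 2 ^ j * 2 ^ k * triangle_count B (2 ^ i) (2 ^ j) (2 ^ k))%N.
Proof.
rewrite /triangles /triangle_count.
have dy d : (rep B d <= 2 * \sum_(i < L) 2 ^ i * (2 ^ i <= rep B d))%N.
  have := @dyadic_pow #|` B| (rep B d) 1 (rep_le_card B d) isT.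
  by rewrite !expn1; under eq_bigr do rewrite expn1.
apply: leq_trans (_ : \sum_(z <- B) \sum_(y <- B) \sum_(x <- B)
  \sum_(i < L) \sum_(j < L) \sum_(k < L) 8 * (2 ^ i * 2 ^ j * 2 ^ k * (
  (2 ^ i <= rep B (x - y)%R) * (2 ^ j <= rep B (y - z)%R) * (2 ^ k <= rep B (x - z)%R))) <= _)%N.
  apply: leq_sum => z _; apply: leq_sum => y _; apply: leq_sum => x _.
  apply: leq_trans (leq_mul (leq_mul (dy _) (dy _)) (dy _)) _.
  have e8 a b c : (2 * a * (2 * b) * (2 * c) = 8 * (a * (b * c)))%N by ring.
  rewrite e8 big_distrl big_distrr /=; apply: leq_sum => i _.
  rewrite big_distrl !big_distrr /=; apply: leq_sum => j _.
  rewrite !big_distrr /=; apply: leq_sum => k _; apply: eq_leq; ring.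
apply: eq_leq; rewrite big_distrr /=.
under eq_bigr do under eq_bigr do rewrite exchange_big /=.
under eq_bigr do rewrite exchange_big /=.
rewrite exchange_big; apply: eq_bigr => i _ /=; rewrite big_distrr /=.
under eq_bigr do under eq_bigr do rewrite exchange_big /=.
under eq_bigr do rewrite exchange_big /=.
rewrite exchange_big; apply: eq_bigr => j _ /=; rewrite big_distrr /=.
under eq_bigr do under eq_bigr do rewrite exchange_big /=.
under eq_bigr do rewrite exchange_big /=.
rewrite exchange_big; apply: eq_bigr => k _ /=; rewrite !big_distrr /=.
apply: eq_bigr => z _; rewrite !big_distrr /=.
by apply: eq_bigr => y _; rewrite !big_distrr.
Qed.

Lemma mem_level B k x y : x \in B -> y \in B ->
  (x - y \in level B k) = (k <= rep B (x - y))%N.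
Proof. by move=> xB yB; rewrite !inE mem_diffs. Qed.

(** A triangle is determined by [d = x - y], [e = y - z] and [z], where [d + e] is
   [x - z]; let [rho d e] be the number of [z]. Summing [rho d e ^ 2] over
   [d] and [e] counts pairs [z, z'] together with [y, x] such that [y + t] and
   [x + t] are in [B] for [t = z' - z]: at most [rep B t ^ 2] for each pair, and
   so at most the sum of the [rep B t ^ 3] in total. *)
Lemma triangle_count_sq_le B k1 k2 k3 :
  (triangle_count B k1 k2 k3 ^ 2
    <= additive_triple_count (level B k1) (level B k2) (level B k3) * energy3 B)%N.
Proof.
set D1 := level B k1; set D2 := level B k2; set D3 := level B k3.
pose rho d e := (\sum_(z <- B) ((z + e)%R \in B) * ((z + e + d)%R \in B))%N.
have countE : (triangle_count B k1 k2 k3 =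
    \sum_(d <- D1) \sum_(e <- D2) ((d + e)%R \in D3) * rho d e)%N.
  transitivity (\sum_(z <- B) \sum_(e <- D2) ((z + e)%R \in B) * (\sum_(d <- D1)
      ((z + e + d)%R \in B) * ((d + e)%R \in D3)))%N.
    rewrite /triangle_count big_seq [RHS]big_seq; apply: eq_bigr => z zB.
    rewrite -sum_shift big_seq [RHS]big_seq; apply: eq_bigr => y yB.
    rewrite -(sum_shift B D1 (z + (y - z)) (fun d => ((d + (y - z))%R \in D3) : nat)).
    rewrite subrKC big_distrr big_seq [RHS]big_seq; apply: eq_bigr => x xB /=.
    by rewrite addrA subrK !mem_level // mulnA (mulnC (_ <= _)%N).
  rewrite exchange_big /= [RHS]exchange_big /=; apply: eq_bigr => e _.
  under eq_bigr do rewrite big_distrr /=.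
  rewrite exchange_big /=; apply: eq_bigr => d _; rewrite big_distrr /=.
  by apply: eq_bigr => z _; rewrite mulnA mulnC.
have rho2 : (\sum_(d <- D1) \sum_(e <- D2) rho d e ^ 2 <= energy3 B)%N.
  have -> : energy3 B = (\sum_(z <- B) \sum_(z' <- B) rep B (z' - z)%R ^ 2)%N.
    rewrite (moment_pairs B (fun d => rep B d ^ 2)%N).
    by apply: eq_bigr => d _; rewrite expnS.
  under eq_bigr do under eq_bigr do rewrite -mulnn big_distrlr /=.
  under eq_bigr do rewrite exchange_big /=.
  rewrite exchange_big /=; apply: leq_sum => z _.
  under eq_bigr do rewrite exchange_big /=.
  rewrite exchange_big /=; apply: leq_sum => z' _.
  rewrite exchange_big /=; set t := z' - z.
  apply: leq_trans (_ : \sum_(e <- D2) ((z + e)%R \in B) * ((z + e + t)%R \in B) * rep B t <= _)%N.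
    apply: leq_sum => e _; rewrite repE.
    have -> : z' + e = z + e + t by rewrite /t; ring.
    apply: leq_trans (leq_mul (leqnn _) (sum_shift_le B D1 (z + e) (fun x => ((x + t)%R \in B) : nat))).
    rewrite big_distrr; apply: leq_sum => d _ /=.
    by rewrite mulnACA (addrAC _ t).
  rewrite -big_distrl -mulnn /= leq_mul2r; apply/orP; right; rewrite [leqRHS]repE.
  exact: (sum_shift_le B D2 z (fun x => ((x + t)%R \in B) : nat)).
pose s := [seq (d, e) | d <- D1, e <- D2].
have := cauchy_schwarz s (fun p => ((p.1 + p.2)%R \in D3) : nat) (fun p => rho p.1 p.2).
rewrite !big_allpairs /= -countE => /leq_trans; apply; apply: leq_mul rho2.
apply: leq_sum => d _; apply: leq_sum => e _.
by case: (_ \in D3).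
Qed.

(** Here only triples with [x = z] are counted. For them [k3 <= rep B 0 = #|B|],
   and the two other thresholds are at most [rep B (y - z)]. *)
Lemma degenerate_triangles B k1 k2 k3 :
  (forall d, d \in level B k3 -> d = 0) ->
  (k1 * k2 * k3 * triangle_count B k1 k2 k3 <= #|` B| * energy3 B)%N.
Proof.
move=> D30; have -> : energy3 B = (\sum_(z <- B) \sum_(y <- B) rep B (y - z)%R ^ 2)%N.
  rewrite (moment_pairs B (fun d => rep B d ^ 2)%N).
  by apply: eq_bigr => d _; rewrite expnS.
rewrite /triangle_count !big_distrr /=; apply: leq_sum_fset => z zB.
rewrite !big_distrr /=; apply: leq_sum_fset => y yB.
apply: leq_trans (_ : \sum_(x <- B) (x == z) * (#|` B| * rep B (y - z) ^ 2) <= _)%N; last first.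
  by rewrite sum_pick zB mul1n.
rewrite big_distrr /=; apply: leq_sum_fset => x xB.
case: (leqP k3) => [k3r|]; last by rewrite !muln0.
have xz : x = z by apply/subr0_eq/D30; rewrite mem_level.
rewrite xz eqxx mul1n muln1 (rep_sym zB yB).
case: (leqP k1) => [k1r|_]; last by rewrite muln0.
case: (leqP k2) => [k2r|_]; last by rewrite !muln0.
rewrite !muln1 mulnC leq_mul ?(leq_trans k3r (rep_le_card _ _)) //.
by rewrite -mulnn leq_mul.
Qed.

End Triangles.

(** * The upper bound for the energy *)

(** In the intended use [D1], [D2] and [H] are the sizes of two level sets and of
   a dilated one, and [S] counts triangles. Multiplying by [n ^ 7] makes the powers of [k1], [k2] and [k3]
   exactly those that the bounds for these sizes absorb. *)
Lemma combine_bounds a L P n D1 D2 H k1 k2 k3 N E S :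
  (0 < n -> 0 < L -> S ^ 2 <= N * E ->
   N ^ 3 * n <= a * (D1 * D2 * H) ^ 2 ->
   D1 * k1 ^ 3 <= a * (P ^ 2 * n) -> D2 * k2 ^ 3 <= a * (P ^ 2 * n) ->
   H * k3 ^ 3 * n ^ 3 <= a * P ^ 6 -> E <= L * (8 * a * (P ^ 2 * n)) ->
   (k1 * k2 * k3 * S) ^ 6 <= (8 * a) ^ 10 * (L ^ 6 * P ^ 26))%N.
Proof.
move=> n0 L0 hS hN h1 h2 h3 hE.
have hS6 : (S ^ 6 <= N ^ 3 * E ^ 3)%N by rewrite (expnM S 2 3) -expnMn leq_exp2r.
have hE3 : (E ^ 3 <= (L * (8 * a * (P ^ 2 * n))) ^ 3)%N by rewrite leq_exp2r.
have hD : ((D1 * k1 ^ 3 * (D2 * k2 ^ 3) * (H * k3 ^ 3 * n ^ 3)) ^ 2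
    <= (a * (P ^ 2 * n) * (a * (P ^ 2 * n)) * (a * P ^ 6)) ^ 2)%N.
  by rewrite leq_exp2r //; do 2!apply: leq_mul => //.
rewrite -(leq_pmul2r (_ : 0 < n ^ 7)%N) ?expn_gt0 ?n0 //.
apply: leq_trans (_ : (k1 * k2 * k3) ^ 6 * (N ^ 3 * E ^ 3) * n ^ 7 <= _)%N.
  by rewrite expnMn leq_mul2r leq_mul2l hS6 !orbT.
apply: leq_trans (_ : N ^ 3 * n * ((k1 * k2 * k3) ^ 6 * n ^ 6 * E ^ 3) <= _)%N.
  by apply: eq_leq; ring.
apply: leq_trans (leq_mul hN (leqnn _)) _.
apply: leq_trans (_ : a * ((D1 * k1 ^ 3 * (D2 * k2 ^ 3) * (H * k3 ^ 3 * n ^ 3)) ^ 2 * E ^ 3)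
  <= _)%N; first by apply: eq_leq; ring.
apply: leq_trans (leq_mul (leqnn a) (leq_mul hD hE3)) _.
apply: leq_trans (_ : 8 ^ 3 * a ^ 10 * (L ^ 3 * P ^ 26) * n ^ 7 <= _)%N.
  by apply: eq_leq; ring.
rewrite expnMn; do 3![apply: leq_mul => //]; exact: leq_pexp2l.
Qed.

Lemma sum_ord_leq n (F : 'I_n -> nat) k :
  (forall i, F i <= k)%N -> (\sum_(i < n) F i <= n * k)%N.
Proof.
move=> Fk; rewrite -[X in (_ <= X * _)%N]card_ord -sum_nat_const.
by apply: leq_sum => i _.
Qed.

Section Energy.
Variable R : realFieldType.
Implicit Types B : {fset R}.

(** If [level B k3] has a nonzero element, its dilates by [B] make the dilated level
   as large as [B], as [additive_triple_count_le] needs; otherwise the triangles are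
   degenerate and the bound is far from tight. *)
Lemma triangle_count_le B k1 k2 k3 (L := (trunc_log 2 #|` B|).+1) :
  0 \notin B -> B != fset0 ->
  ((k1 * k2 * k3 * triangle_count B k1 k2 k3) ^ 6
    <= (8 * 2000) ^ 10 * (L ^ 6 * #|` mulset B B| ^ 26))%N.
Proof.
move=> B0 Bn0; have E3 := energy3_le B0.
have n0 : (0 < #|` B|)%N by rewrite cardfs_gt0.
have h1 := card_level k1 B0; have h2 := card_level k2 B0.
have h3 := card_dilated_level k3 B0.
have hS := triangle_count_sq_le B k1 k2 k3.
have [b bB bn0] := nonempty_nonzero B0 Bn0.
have nP : (#|` B| <= #|` mulset B B|)%N := card_mulset_ge _ bB bn0.
have [/allP D30|/allPn[d dD3 dn0]] := boolP (all (pred1 0) (level B k3)).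
  have := degenerate_triangles k1 k2 (fun d dD => eqP (D30 d dD)).
  move/leq_trans => /(_ _ (leq_mul (leqnn _) E3)).
  move: n0 nP; rewrite -/L.
  move: L (triangle_count _ _ _ _) #|` B| #|` mulset B B| (2000)%N (isT : 0 < 2000)%N.
  move=> L S n P a a0 n0 nP h; have P0 := leq_trans n0 nP.
  rewrite -(leq_exp2r _ _ (_ : 0 < 6)%N) // in h; apply: leq_trans h _.
  apply: leq_trans (_ : (P * (L * (8 * a * (P ^ 2 * P)))) ^ 6 <= _)%N.
    by rewrite leq_exp2r //; do 4!apply: leq_mul => //.
  apply: leq_trans (_ : (8 * a) ^ 6 * (L ^ 6 * P ^ 24) <= _)%N; first by apply: eq_leq; ring.
  by apply: leq_mul; [|apply: leq_mul => //]; rewrite leq_pexp2l // muln_gt0.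
have nH : (#|` B| <= #|` mulset B (level B k3)|)%N by apply: card_mulset_ge dD3 dn0.
apply: combine_bounds hS _ h1 h2 h3 _ => //.
exact: additive_triple_count_le.
Qed.

(** Each dyadic block is at most the greatest [m] with [m ^ 6 <= Z], which stands
   for the sixth root of [Z]; there are [L ^ 3] blocks. *)
Lemma energy_le_mulset : exists C : nat, forall B, 0 \notin B -> B != fset0 ->
  (energy B ^ 18 <= C * (#|` B| ^ 18 * (trunc_log 2 #|` B|).+1 ^ 24
     * #|` mulset B B| ^ 26))%N.
Proof.
exists (8 ^ 6 * (8 * 2000) ^ 10)%N => B B0 Bn0; set L := (trunc_log 2 _).+1.
have := triangle_count_le _ _ _ B0 Bn0; rewrite -/L.
move: ((8 * 2000) ^ 10)%N => C count_le.
set Z := (C * (L ^ 6 * #|` mulset B B| ^ 26))%N.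
have ex : exists m, (m ^ 6 <= Z)%N by exists 0%N.
have ub m : (m ^ 6 <= Z -> m <= Z)%N.
  by apply: leq_trans; case: m => // m; rewrite -{1}(expn1 m.+1) leq_pexp2l.
case: (ex_maxnP ex ub) => m mZ max_m.
have tri : (triangles B <= 8 * (L * (L * (L * m))))%N.
  apply: leq_trans (triangles_dyadic B) _; rewrite leq_mul2l /= -/L.
  do 3![apply: sum_ord_leq => ?]; exact/max_m/count_le.
have tri6 : (triangles B ^ 6 <= 8 ^ 6 * (L ^ 18 * Z))%N.
  apply: leq_trans (_ : (8 * (L * (L * (L * m)))) ^ 6 <= _)%N; first by rewrite leq_exp2r.
  apply: leq_trans (_ : 8 ^ 6 * (L ^ 18 * m ^ 6) <= _)%N; first by apply: eq_leq; ring.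
  by rewrite !leq_mul2l mZ !orbT.
have := energy_le_triangles B; rewrite -(leq_exp2r _ _ (_ : 0 < 6)%N) // -expnM expnMn -expnM.
move=> /leq_trans; apply; apply: leq_trans (leq_mul (leqnn _) tri6) _.
by apply: eq_leq; rewrite /Z; ring.
Qed.

End Energy.

(** * Sets containing zero *)

Section RemoveZero.
Variable R : realFieldType.
Implicit Types A B : {fset R}.

Lemma sum_without0 A (F : R -> nat) :
  (\sum_(x <- A) F x <= F 0%R + \sum_(x <- A `\ 0%R) F x)%fset%N.
Proof.
have [A0|A0] := boolP (0 \in A); first by rewrite (big_fsetD1 0).
by rewrite mem_fsetD1 // leq_addl.
Qed.

(** Only [g = 0] and [g = - d] can be lost. *)
Lemma rep_without0 A d : (rep A d <= rep (A `\ 0%R)%fset d + 2)%N.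
Proof.
pose E := [fset 0%R; (- d)%R]%fset.
apply: leq_trans (_ : #|` ([fset g in A `\ 0%R | (g + d)%R \in A `\ 0%R] `|` E)%fset| <= _)%N.
  apply/fsubset_leq_card/fsubsetP => g; rewrite !inE -(addr_eq0 g d).
  by case: (g == 0) => //=; case: (g + d == 0); rewrite ?orbT ?orbF.
rewrite cardfsU leq_subLR; apply: leq_trans (leq_addl _ _); rewrite leq_add2l.
by rewrite cardfs2; case: (_ != _).
Qed.

Lemma card_sq_le_energy B : (#|` B| ^ 2 <= energy B)%N.
Proof.
rewrite -mulnn -sum_fset_const; apply: leq_sum_fset => z zB.
rewrite (big_fsetD1 z zB) /= subrr; apply: leq_trans (leq_addr _ _).
rewrite repE card_fset_sum1; apply: leq_sum_fset => g gB.
by rewrite addr0 gB.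
Qed.

(** The pairs involving 0 cost at most [4 |A| ^ 2], which is [16 |B| ^ 2] at most
   and so is absorbed by [card_sq_le_energy]. *)
Lemma energy_without0 A : (1 < #|` A|)%N -> (energy A <= 17 * energy (A `\ 0%R)%fset)%N.
Proof.
move=> A2; set B := (A `\ 0%R)%fset.
have AB : (#|` A| <= 2 * #|` B|)%N.
  have : (#|` A| <= 1 + #|` B|)%N by rewrite (cardfsD1 0 A) leq_add2r leq_b1.
  by move: A2; case: #|` B| => [|n]; lia.
have BA : (#|` B| <= #|` A|)%N by apply/fsubset_leq_card/fsubD1set.
have energyA : (energy A <= energy B + 4 * #|` A| ^ 2)%N.
  apply: leq_trans (_ : \sum_(z <- A) \sum_(y <- A) (rep B (y - z)%R + 2) <= _)%N.
    by apply: leq_sum => z _; apply: leq_sum => y _; apply: rep_without0.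
  under eq_bigr do rewrite big_split /= sum_fset_const.
  rewrite big_split /= sum_fset_const.
  have repA d : (rep B d <= #|` A|)%N := leq_trans (rep_le_card B d) BA.
  have inner z : (\sum_(y <- A) rep B (y - z)%R <= #|` A| + \sum_(y <- B) rep B (y - z)%R)%N.
    by apply: leq_trans (sum_without0 A _) _; rewrite leq_add2r.
  have outer : (\sum_(z <- A) \sum_(y <- A) rep B (y - z)%R
      <= #|` A| * #|` A| + \sum_(z <- B) \sum_(y <- A) rep B (y - z)%R)%N.
    by apply: leq_trans (sum_without0 A _) _; rewrite leq_add2r; apply: sum_fset_leq.
  have rest : (\sum_(z <- B) \sum_(y <- A) rep B (y - z)%R <= #|` B| * #|` A| + energy B)%N.
    by rewrite -sum_fset_const -big_split; apply: leq_sum.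
  have := leq_mul BA (leqnn #|` A|); rewrite -mulnn.
  move: outer rest; move: (\sum_(z <- A) _)%N (\sum_(z <- B) _)%N => p q outer rest bA.
  apply: leq_trans (leq_add (leq_trans outer (leq_add (leqnn _) rest)) (leqnn _)) _.
  by move: bA; move: #|` A| #|` B| (energy B); lia.
have := card_sq_le_energy B; have := leq_mul AB AB; rewrite mulnACA !mulnn.
move: energyA; lia.
Qed.

End RemoveZero.

(** * The energy as a count of quadruples *)

Lemma sum_fsetM (T U : choiceType) (A : {fset T}) (B : {fset U}) (F : T * U -> nat) :
  (\sum_(p <- (A `*` B)%fset) F p = \sum_(x <- A) \sum_(y <- B) F (x, y))%N.
Proof. by rewrite /fsetM big_imfset2 // => -[x y] [x' y'] _ _ /= [-> ->]. Qed.

(** [a + b = c + d] means that [d = b + (a - c)]. *)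
Lemma additive_energyE (R : realType) (A : {fset R}) : additive_energy A = energy A.
Proof.
rewrite /additive_energy card_sep_sum !sum_fsetM /= /energy.
rewrite [RHS]exchange_big; apply: eq_bigr => a _ /=.
rewrite exchange_big; apply: eq_bigr => c _ /=; rewrite repE; apply: eq_bigr => b _.
rewrite mem_sum; apply: eq_bigr => d _.
congr nat_of_bool; apply/eqP/eqP => [abcd|->]; last by ring.
by apply: (addrI c); rewrite -abcd; ring.
Qed.

(** * Conclusion *)

Lemma energy_le_product_set (R : realType) : exists K : nat, forall A : {fset R},
  (2 <= #|` A|)%N ->
  (#|` A| <= #|` product_set A|)%N /\
  (energy A ^ 18 <= K * (#|` A| ^ 18 * (trunc_log 2 #|` A|).+1 ^ 24
     * #|` product_set A| ^ 26))%N.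
Proof.
have [K energy_le] := energy_le_mulset R.
exists (17 ^ 18 * K)%N => A A2; set B := (A `\ 0%R)%fset.
have B0 : 0 \notin B by rewrite !inE eqxx.
have BA : (B `<=` A)%fset := fsubD1set _ _.
have Bn0 : B != fset0.
  rewrite -cardfs_gt0; have := cardfsD1 0 A; rewrite -/B => NE; move: A2.
  by rewrite NE; case: (0 \in A); case: #|` B|.
have [b bB bn0] := nonempty_nonzero B0 Bn0.
split; first exact: card_mulset_ge (fsubsetP BA _ bB) bn0.
have BN : (#|` B| <= #|` A|)%N := fsubset_leq_card BA.
have BP : (#|` mulset B B| <= #|` product_set A|)%N.
  apply: fsubset_leq_card; apply: fsubset_trans (mulset_subl _ BA) _.
  by rewrite mulsetC; apply: mulset_subl.
apply: leq_trans (_ : (17 * energy B) ^ 18 <= _)%N.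
  by rewrite leq_exp2r // energy_without0.
rewrite expnMn -mulnA leq_mul2l; apply/orP; right.
apply: leq_trans (energy_le _ B0 Bn0) _; rewrite leq_mul2l; apply/orP; right.
by apply: leq_mul; [apply: leq_mul|]; rewrite leq_exp2r // ltnS leq_trunc_log.
Qed.

Lemma trunc_log2_le (R : realType) (n : nat) : (2 <= n)%N ->
  (trunc_log 2 n).+1%:R <= 2 * log2 n%:R :> R /\ 1 <= log2 n%:R :> R.
Proof.
move=> n2; have n0 : 0 < n%:R :> R by rewrite ltr0n (leq_trans _ n2).
have ln2 : 0 < ln 2 :> R by rewrite ln_gt0 // ltr1n.
have l1 : 1 <= log2 n%:R :> R.
  by rewrite /log2 ler_pdivlMr // mul1r ler_ln ?posrE // ler_nat.
split=> //; suff : (trunc_log 2 n)%:R <= log2 n%:R :> R by rewrite -natr1; lra.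
rewrite /log2 ler_pdivlMr // mulr_natl -lnXn // ler_ln ?posrE ?exprn_gt0 //.
by rewrite -natrX ler_nat trunc_logP // (leq_trans _ n2).
Qed.

Theorem theorem9 (R : realType) :
  exists C c : R, [/\ 0 < C, 0 < c &
    forall (A : {fset R}) (M : R),
      (2 <= #|` A|)%N ->
      #|` product_set A|%:R <= M * #|` A|%:R ->
      (additive_energy A)%:R <=
        C * (log2 #|` A|%:R) `^ c * M `^ (7 / 3) * #|` A|%:R `^ (22 / 9)].
Proof.
have [K energy_le] := energy_le_product_set R.
have [C C1 KC] : exists2 C : R, 1 <= C & K%:R * 2 ^+ 24 <= C.
  exists (K%:R * 2 ^+ 24 + 1); last by rewrite lerDl.
  by rewrite lerDr mulr_ge0 // exprn_ge0.
(* The logarithm enters [energy_le] with the exponent 24, under an 18th root. *)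
exists C, (4 / 3); split => [||A M A2 small]; first exact: lt_le_trans C1.
  by rewrite divr_gt0.
rewrite additive_energyE; have [NP nat_bound] := energy_le A A2.
have [Ll l1] := trunc_log2_le R A2.
have real_bound : (energy A)%:R ^+ 18 <= K%:R * (#|` A|%:R ^+ 18 *
    (trunc_log 2 #|` A|).+1%:R ^+ 24 * #|` product_set A|%:R ^+ 26) :> R.
  by rewrite -!natrX -!natrM ler_nat.
rewrite -(ler_nat R) in NP; rewrite -(ler_nat R) in A2.
have Ege0 := ler0n R (energy A); have Pge0 := ler0n R #|` product_set A|.
have Lge0 := ler0n R (trunc_log 2 #|` A|).+1; have Kge0 := ler0n R K.
move: Kge0 Lge0 Pge0 Ege0 KC A2 NP real_bound Ll l1 small {nat_bound energy_le}.
move: K%:R (_.+1%:R) (#|` A|%:R) (#|` product_set A|%:R) (energy A)%:R (log2 _).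
move=> k L N P E l k0 L0 P0 E0 kC N2 NP bound Ll l1 small.
have N0 : 0 < N by apply: lt_le_trans N2.
have M1 : 1 <= M by rewrite -(ler_pM2r N0) mul1r (le_trans NP).
have M0 : 0 < M := lt_le_trans ltr01 M1.
have l0 : 0 < l := lt_le_trans ltr01 l1.
have C0 : 0 < C := lt_le_trans ltr01 C1.
have powR18 (x y z : R) : 0 <= x -> y * 18%:R = z -> (x `^ y) ^+ 18 = x `^ z.
  by move=> x0 <-; rewrite -powR_mulrn ?powR_ge0 // -powRrM.
have rhs0 : 0 <= C * l `^ (4 / 3) * M `^ (7 / 3) * N `^ (22 / 9).
  by rewrite !mulr_ge0 ?powR_ge0 // ltW.
rewrite -(ler_pXn2r (_ : 0 < 18)%N) ?nnegrE //.
have -> : (C * l `^ (4 / 3) * M `^ (7 / 3) * N `^ (22 / 9)) ^+ 18 =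
    C ^+ 18 * (l ^+ 24 * M ^+ 42 * N ^+ 44).
  rewrite !exprMn (powR18 l _ 24%:R) ?(powR18 M _ 42%:R) ?(powR18 N _ 44%:R) ?ltW //; try lra.
  by rewrite !powR_mulrn ?ltW // !mulrA.
have L24 : L ^+ 24 <= 2 ^+ 24 * l ^+ 24.
  by rewrite -exprMn lerXn2r ?nnegrE ?mulr_ge0 ?(ltW l0).
have P26 : P ^+ 26 <= M ^+ 42 * N ^+ 26.
  apply: (@le_trans _ _ ((M * N) ^+ 26)).
    by rewrite lerXn2r ?nnegrE ?mulr_ge0 ?(ltW M0) ?(ltW N0).
  by rewrite exprMn ler_wpM2r ?exprn_ge0 ?(ltW N0) // ler_weXn2l.
have C18 : k * 2 ^+ 24 <= C ^+ 18.
  by apply: le_trans kC _; rewrite -[leLHS]expr1 ler_weXn2l.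
apply: le_trans bound _.
apply: (@le_trans _ _ (k * (N ^+ 18 * (2 ^+ 24 * l ^+ 24) * (M ^+ 42 * N ^+ 26)))).
  rewrite ler_wpM2l // ler_pM ?mulr_ge0 ?exprn_ge0 ?(ltW N0) //.
  by rewrite ler_wpM2l ?exprn_ge0 ?(ltW N0).
apply: (@le_trans _ _ (k * 2 ^+ 24 * (l ^+ 24 * M ^+ 42 * N ^+ 44))); last first.
  rewrite ler_wpM2r //.
  by apply: mulr_ge0; [apply: mulr_ge0|]; rewrite exprn_ge0 // ltW.
rewrite (exprD N 18 26) le_eqVlt; apply/orP; left; apply/eqP.
move: (N ^+ 18) (N ^+ 26) (l ^+ 24) (M ^+ 42) (2 ^+ 24) => a b c d e.
by ring.
Qed.
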